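(* Let $n\ge 3$ and $K>0$, and let $r\in\mathbb{Z}+\frac12$ be a half-integer with $-\frac n4+\frac12<r<\frac n4-\frac12$. Then $u^{(r)}$, the point with components $u^{(r)}_i=\frac{ri}{n-2}$ for $i=0,\dots,n-1$, is a $1$-saddle of the nearest-neighbor Kuramoto model, i.e. it is a critical point of $U$ and the Hessian matrix $\frac{\partial^2U}{\partial u^2}(u^{(r)})$ has (counted with multiplicity) one negative eigenvalue, the eigenvalue zero once, and $n-2$ positive eigenvalues.
   Context: Indices are taken in $\Lambda=\mathbb{Z}/n\mathbb{Z}$ with representatives $0,\dots,n-1$. The potential of the nearest-neighbor Kuramoto model is $U:\mathbb{R}^{\Lambda}\to\mathbb{R}$, $U(u)=-\frac{K}{2\pi}\sum_{i\in\Lambda}\cos(2\pi(u_{i+1}-u_i))$, and the model is $\dot u=-\nabla U(u)$, i.e. $\dot u_i=K[\sin(2\pi(u_{i+1}-u_i))+\sin(2\pi(u_{i-1}-u_i))]$. *)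

(* Defs.v *)
From HB Require Import structures.
From mathcomp Require Import all_boot all_order all_algebra.
From mathcomp Require Import all_classical all_reals all_analysis.

Set Implicit Arguments.
Unset Strict Implicit.
Unset Printing Implicit Defensive.

Import Order.TTheory GRing.Theory Num.Theory.
Import numFieldNormedType.Exports.

Local Open Scope classical_set_scope.
Local Open Scope ring_scope.

Definition gradient (R : realType) (n : nat) (f : 'rV[R]_n -> R)
    (u : 'rV[R]_n) : 'rV[R]_n :=
  \row_i 'D_(delta_mx 0 i) f u.

Definition hessian (R : realType) (n : nat) (f : 'rV[R]_n -> R)
    (u : 'rV[R]_n) : 'M[R]_n :=
  \matrix_(i, j) 'D_(delta_mx 0 j) (fun x => 'D_(delta_mx 0 i) f x) u.

(* Directional derivatives are total functions with an arbitrary value where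
   the derivative does not exist; this rules such values out of the gradient
   and the Hessian at u. *)
Definition twice_differentiable_at (R : realType) (n : nat)
    (f : 'rV[R]_n -> R) (u : 'rV[R]_n) : Prop :=
  (\forall x \near u, differentiable f x) /\ differentiable (gradient f) u.

Definition is_critical_point (R : realType) (n : nat) (f : 'rV[R]_n -> R)
    (u : 'rV[R]_n) : Prop :=
  differentiable f u /\ gradient f u = 0.

(* s lists all the eigenvalues of A, repeated according to their algebraic
   multiplicity; in particular all of them lie in R. *)
Definition is_spectrum (R : realType) (n : nat) (A : 'M[R]_n) (s : seq R)
    : Prop :=
  char_poly A = \prod_(x <- s) ('X - x%:P).

(* The zero eigenvalue, required to be simple, comes from the invariance of
   the Kuramoto potential under u |-> u + const. *)
Definition is_saddle (R : realType) (n : nat) (k : nat) (f : 'rV[R]_n -> R)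
    (u : 'rV[R]_n) : Prop :=
  [/\ twice_differentiable_at f u,
      is_critical_point f u
    & exists s : seq R,
        [/\ is_spectrum (hessian f u) s,
            count (fun x => x < 0) s = k,
            count (fun x => x == 0) s = 1%N
          & count (fun x => 0 < x) s = (n - 1 - k)%N]].

(* ordS i is i + 1 modulo n. *)
Definition kuramoto_potential (R : realType) (n : nat) (K : R)
    (u : 'rV[R]_n) : R :=
  - (K / (2 * pi)) *
    \sum_(i < n) cos (2 * pi * (u 0 (ordS i) - u 0 i)).

Definition half_twisted_state (R : realType) (n : nat) (r : R) : 'rV[R]_n :=
  \row_(i < n) (r * i%:R / (n%:R - 2)).

(* Main.v *)
(* Along the path 0, ..., n - 1 all the increments of u^(r) equal t = r/(n-2)
   with |t| < 1/4, and the increment over the closing edge (n-1, 0) is -(r + t).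
   Since r is a half-integer, the sines of both phases agree, so the point is
   critical, and the cosines are opposite: the Hessian is a positive multiple of
   P - e e^T, where P is the Laplacian of the path and e is the difference of the
   two end vectors.  The form is positive semidefinite on the hyperplane e x = 0,
   so there is at most one negative eigenvalue; the linear profile x_i = i makes
   the form negative; and pairing a kernel vector with that profile shows that it
   lies in the hyperplane, hence is constant. *)

Require Import Defs.
From HB Require Import structures.
From mathcomp Require Import all_boot all_order all_algebra.
From mathcomp Require Import all_classical all_reals all_analysis.
From mathcomp Require Import ring lra zify complex.

Set Implicit Arguments.
Unset Strict Implicit.
Unset Printing Implicit Defensive.

Import Order.TTheory GRing.Theory Num.Theory.
Import numFieldNormedType.Exports.

Local Open Scope ring_scope.
Local Open Scope sesquilinear_scope.

(** The increment over the edge from [k] to its cyclic successor. Any [zmodType] is allowed, since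
    both real states and complex test vectors are used. *)
Definition jump (R : zmodType) (n : nat) (k : 'I_n) (x : 'rV[R]_n) : R :=
  x 0 (ordS k) - x 0 k.

(** * Gradient and Hessian of the potential in terms of edge increments *)

Section Derivatives.
Variables (R : realType) (n : nat).
Implicit Types (K : R) (u x v : 'rV[R]_n) (k : 'I_n).

Lemma differentiable_jump k x : differentiable (jump k : 'rV[R]_n -> R) x.
Proof. by apply: differentiableB; exact: differentiable_coord. Qed.

Lemma is_diff_jump k x : is_diff x (jump k : 'rV[R]_n -> R) (jump k).
Proof.
have lin : linear (jump k : 'rV[R]_n -> R).
  by move=> a y z; rewrite /jump !mxE /GRing.scale /=; ring.
pose f : {linear 'rV[R]_n -> R} := HB.pack (jump k : 'rV[R]_n -> R)
  (GRing.isLinear.Build R 'rV[R]_n R _ _ lin).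
apply: DiffDef; first exact: differentiable_jump.
apply: (@diff_lin _ _ _ f) => y.
exact/differentiable_continuous/differentiable_jump.
Qed.

(** The chain rule in the form shared by the cosines of the potential and the sines of its
    gradient. *)
Lemma is_diff_comp_jump k x (a : R) (g : R -> R) (dg : R) :
  is_derive (a * jump k x) 1 g dg ->
  is_diff x (fun y : 'rV[R]_n => g (a * jump k y)) (fun v => a * dg * jump k v).
Proof.
move=> [dg1 dgE].
have dl : is_diff x (fun y : 'rV[R]_n => a * jump k y) (fun v => a * jump k v).
  by have ? := is_diff_jump k x; exact: is_diffZ.
have dgd : differentiable g (a * jump k x) by apply/derivable1_diffP.
have := is_diff_comp dl (differentiableP dgd).
move=> h; apply: (is_diff_eq h).
apply/funext => v /=.
by rewrite -[a * jump k v]mulr1 [LHS]linearZ /= -deriveE // dgE /GRing.scale /=; ring.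
Qed.

Lemma is_diff_kuramoto_potential K x :
  is_diff x (@kuramoto_potential R n K)
    (fun v => \sum_(k < n) K * sin (2 * pi * jump k x) * jump k v).
Proof.
have h k : is_diff x (fun y : 'rV[R]_n => cos (2 * pi * jump k y))
    (fun v => 2 * pi * - sin (2 * pi * jump k x) * jump k v).
  exact: is_diff_comp_jump.
have hs : is_diff x (\sum_(k < n) (fun y : 'rV[R]_n => cos (2 * pi * jump k y)))
    (\sum_(k < n) (fun v => 2 * pi * - sin (2 * pi * jump k x) * jump k v)).
  elim/big_ind2 : _ => // [|f1 g1 f2 g2 ??]; first exact: is_diff_cst.
  exact: is_diffD.
have := is_diffZ (- (K / (2 * pi))) hs.
rewrite (_ : _ *: _ = @kuramoto_potential R n K).
  move=> h'; apply: (is_diff_eq h'); apply/funext => v /=.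
  rewrite [LHS]/GRing.scale /= fct_sumE scaler_sumr; apply: eq_bigr => k _.
  rewrite /GRing.scale /=.
  have E (s p j : R) : p != 0 -> - (K / (2 * p)) * (2 * p * - s * j) = K * s * j.
    by move=> p0; field.
  by apply: E; rewrite gt_eqF ?pi_gt0.
by apply/funext => y; rewrite /GRing.scale /= fct_sumE.
Qed.

Lemma gradient_kuramoto_potential K : gradient (@kuramoto_potential R n K) =
  fun x => \sum_(k < n) (K * sin (2 * pi * jump k x)) *:
    \row_i jump k (delta_mx 0 i).
Proof.
apply/funext => x; apply/rowP => i; rewrite mxE summxE.
have [d e] := is_diff_kuramoto_potential K x.
by rewrite deriveE // e; apply: eq_bigr => k _; rewrite !mxE.
Qed.

(** This is the Laplacian of the cycle in which edge [k] has weight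
    [2 * pi * K * cos (2 * pi * jump k u)]. *)
Lemma hessian_kuramoto_potential K u : hessian (@kuramoto_potential R n K) u =
  \matrix_(i, j) \sum_(k < n) (2 * pi * K * cos (2 * pi * jump k u)) *
    jump k (delta_mx 0 i) * jump k (delta_mx 0 j).
Proof.
apply/matrixP => i j; rewrite !mxE.
have -> : (fun x => 'D_(delta_mx 0 i) (@kuramoto_potential R n K) x) =
  \sum_(k < n) (K * jump k (delta_mx 0 i : 'rV[R]_n)) *:
    (fun x : 'rV[R]_n => sin (2 * pi * jump k x)).
  apply/funext => x; have [d e] := is_diff_kuramoto_potential K x.
  rewrite deriveE // e fct_sumE; apply: eq_bigr => k _.
  exact: mulrAC.
have h k : is_diff u (fun y : 'rV[R]_n => sin (2 * pi * jump k y))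
    (fun v => 2 * pi * cos (2 * pi * jump k u) * jump k v).
  exact: is_diff_comp_jump.
rewrite derive_sum => [|k]; last by apply/derivableZ/diff_derivable.
apply: eq_bigr => k _.
rewrite deriveZ; last by apply/diff_derivable.
by rewrite deriveE // diff_val /GRing.scale /=; ring.
Qed.

Lemma twice_differentiable_kuramoto_potential K u :
  twice_differentiable_at (@kuramoto_potential R n K) u.
Proof.
split.
  by apply/nbhs_ballP; exists 1 => //= x _; have [] := is_diff_kuramoto_potential K x.
rewrite gradient_kuramoto_potential.
have -> : (fun x => \sum_(k < n) (K * sin (2 * pi * jump k x)) *:
    \row_i jump k (delta_mx 0 i)) =
  \sum_(k < n) (fun x : 'rV[R]_n => (K * sin (2 * pi * jump k x)) *:
    \row_i jump k (delta_mx 0 i : 'rV[R]_n)).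
  by apply/funext => x; rewrite fct_sumE.
apply: differentiable_sum => k; apply: differentiableZl.
have h := is_diff_comp_jump (is_derive_sin (2 * pi * jump k u)).
apply: (@differentiableZ _ _ _ (fun y : 'rV[R]_n => sin (2 * pi * jump k y)) K).
exact: ex_diff.
Qed.

End Derivatives.

(** * Spectral decomposition of real symmetric matrices *)

Lemma char_poly_similar (F : fieldType) n (P D : 'M[F]_n) :
  P \in unitmx -> char_poly (invmx P *m D *m P) = char_poly D.
Proof.
move=> Pu; rewrite /char_poly; pose C := map_mx (@polyC F).
have CP : C _ _ (invmx P) *m C _ _ P = 1%:M.
  by rewrite -map_mxM mulVmx // map_mx1.
have -> : char_poly_mx (invmx P *m D *m P) =
    C _ _ (invmx P) *m char_poly_mx D *m C _ _ P.
  rewrite /char_poly_mx mulmxBr mulmxBl !map_mxM -/C; congr (_ - _).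
  by rewrite scalar_mxC -mulmxA CP mulmx1.
rewrite !det_mulmx mulrC mulrA -det_mulmx (mulmx1C CP).
by rewrite det1 mul1r.
Qed.

(** Over [R[i]] the matrix is Hermitian, hence unitarily diagonalizable with real eigenvalues. The
    factorization of the characteristic polynomial descends to [R] because the embedding of
    coefficients is injective. The eigenbasis stays complex, so the form is tested on complex
    vectors below. *)
Lemma real_symmetric_spectral (R : rcfType) n (A : 'M[R]_n) : A^T = A ->
  exists (d : 'I_n -> R) (P : 'M[R[i]]_n),
  [/\ P \is unitarymx,
      map_mx (real_complex R) A = P^t* *m diag_mx (\row_i real_complex R (d i)) *m P
    & char_poly A = \prod_i ('X - (d i)%:P)].
Proof.
move=> Asym; set AC := map_mx _ A.
have ACh : AC \is hermsymmx.
  apply: realsym_hermsym.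
    apply/is_hermitianmxP.
    by rewrite expr0 scale1r map_mx_id // /AC map_trmx Asym.
  by apply/mxOverP => i j; rewrite mxE complex_real.
have dr := hermitian_spectral_diag_real ACh.
have /orthomx_spectralP ACE := hermitian_normalmx ACh.
have Pu := spectral_unitarymx AC.
pose d i := complex.Re (spectral_diag AC 0 i).
have dE : spectral_diag AC = \row_i real_complex R (d i).
  apply/rowP => i; rewrite mxE RRe_real //.
  by move/mxOverP : dr; exact.
exists d, (spectralmx AC); split=> //.
  by rewrite -dE -invmx_unitary.
apply: (map_poly_inj (real_complex R)).
rewrite map_char_poly -/AC [in LHS]ACE char_poly_similar ?spectral_unit // dE.
rewrite char_poly_trig; last exact/is_diag_mx_is_trig/diag_mx_is_diag.
rewrite rmorph_prod; apply: eq_bigr => i _.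
by rewrite !mxE eqxx mulr1n rmorphB /= map_polyX map_polyC.
Qed.

Lemma unitary_diag_form (C : numClosedFieldType) n (P : 'M[C]_n) (d c : 'rV[C]_n) :
  P \is unitarymx ->
  ((c *m P) *m (P^t* *m diag_mx d *m P) *m (c *m P)^t*) 0 0 =
  \sum_i d 0 i * `|c 0 i| ^+ 2.
Proof.
move=> /unitarymxP PP.
rewrite trmx_mul map_mxM !mulmxA -(mulmxA c P) PP mulmx1.
rewrite -(mulmxA _ P) PP mulmx1 mxE; apply: eq_bigr => i _.
by rewrite mul_mx_diag !mxE normCK mulrA [d 0 i * _]mulrC.
Qed.

(** * Counting negative and zero eigenvalues from the form and the kernel *)

Section Inertia.
Variables (R : rcfType) (n : nat) (A : 'M[R]_n) (d : 'I_n -> R) (P : 'M[R[i]]_n).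
Let AC := map_mx (real_complex R) A.
Hypothesis Pu : P \is unitarymx.
Hypothesis ACE : AC = P^t* *m diag_mx (\row_i real_complex R (d i)) *m P.

Lemma spectral_form (c : 'rV_n) :
  ((c *m P) *m AC *m (c *m P)^t*) 0 0 =
  \sum_i real_complex R (d i) * `|c 0 i| ^+ 2.
Proof.
by rewrite ACE unitary_diag_form //; apply: eq_bigr => i _; rewrite mxE.
Qed.

Lemma row_spectral_eigen i : row i P *m AC = real_complex R (d i) *: row i P.
Proof.
have /unitarymxP PP := Pu.
by rewrite ACE !mulmxA -row_mul PP row1 -rowE row_diag_mx mxE -scalemxAl -rowE.
Qed.

(** Two negative eigenvalues would give a plane on which the form is negative definite, and such a
    plane meets the kernel of [l] in a nonzero vector. *)
Lemma card_neg_eigen_le1 (l : {scalar 'rV[R[i]]_n}) :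
  (forall x, l x = 0 -> 0 <= (x *m AC *m x^t*) 0 0) ->
  (#|[pred i | (d i < 0)%R]| <= 1)%N.
Proof.
move=> psd; apply/card_le1_eqP => i j /[!inE] di dj.
apply/eqP/negP => /negP /negPf ji; have ij : (i == j) = false by rewrite eq_sym.
have [c cn0 lc] : exists2 c : 'rV[R[i]]_n,
    (exists2 k, k \in [:: i; j] & c 0 k != 0) /\
    (forall k, k != i -> k != j -> c 0 k = 0) & l (c *m P) = 0.
  (* A combination of the two eigenvectors killed by l. *)
  pose p := l (row i P); pose q := l (row j P).
  pose c a b : 'rV[R[i]]_n := a *: delta_mx 0 i + b *: delta_mx 0 j.
  have cE a b : l (c a b *m P) = a * p + b * q.
    by rewrite mulmxDl -!scalemxAl -!rowE linearD !linearZ.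
  have ci a b : c a b 0 i = a.
    by rewrite !mxE !eqxx ij mulr1 mulr0 addr0.
  have cj a b : c a b 0 j = b.
    by rewrite !mxE !eqxx ji mulr1 mulr0 add0r.
  have c0 a b k : k != i -> k != j -> c a b 0 k = 0.
    by move=> /negPf ki /negPf kj; rewrite !mxE ki kj !mulr0 addr0.
  have [p0|p0] := eqVneq p 0.
    exists (c 1 0); last by rewrite cE p0 mulr0 mul0r addr0.
    by split=> [|k]; [exists i; rewrite ?inE ?eqxx// ci oner_eq0|exact: c0].
  exists (c (- q) p); last by rewrite cE mulNr mulrC addNr.
  by split=> [|k]; [exists j; rewrite ?inE ?eqxx ?orbT// cj|exact: c0].
have [[k kij ck] c0] := cn0.
have := psd _ lc; rewrite spectral_form; apply/negP; rewrite lt_geF //.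
have dle h : real_complex R (d h) * `|c 0 h| ^+ 2 <= 0.
  have [->|hi] := eqVneq h i.
    by rewrite mulr_le0_ge0 ?exprn_ge0 // (lecR _ 0) ltW.
  have [->|hj] := eqVneq h j.
    by rewrite mulr_le0_ge0 ?exprn_ge0 // (lecR _ 0) ltW.
  by rewrite (c0 h) // normr0 expr0n mulr0.
rewrite (bigD1 k) //= ltr_wnDr //; first exact: sumr_le0.
have dk : d k < 0 by move: kij; rewrite !inE => /orP[] /eqP ->.
by rewrite nmulr_rlt0 ?exprn_gt0 ?normr_gt0 // (ltcR _ 0).
Qed.

Lemma card_neg_eigen_gt0 (x : 'rV[R[i]]_n) :
  (x *m AC *m x^t*) 0 0 < 0 -> (0 < #|[pred i | (d i < 0)%R]|)%N.
Proof.
rewrite -[x](mulmxKV (unitarymx_unit Pu)) spectral_form => neg.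
rewrite lt0n; apply: contraTneq neg => /card0_eq npos.
rewrite le_gtF //; apply: sumr_ge0 => i _.
rewrite mulr_ge0 ?exprn_ge0 // (lecR 0) leNgt.
by have := npos i; rewrite !inE => ->.
Qed.

(** Two rows of [P] for the eigenvalue zero would both be multiples of [e], against the linear
    independence of the rows. *)
Lemma card_zero_eigen_le1 (e : 'rV[R[i]]_n) :
  (forall x : 'rV_n, x *m AC = 0 -> exists a, x = a *: e) ->
  (#|[pred i | d i == 0%R]| <= 1)%N.
Proof.
move=> ker; apply/card_le1_eqP => i j /[!inE] /eqP di /eqP dj.
have [a ai] : exists a, row i P = a *: e.
  by apply: ker; rewrite row_spectral_eigen di scale0r.
have [b bj] : exists b, row j P = b *: e.
  by apply: ker; rewrite row_spectral_eigen dj scale0r.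
have Pf : row_free P by rewrite row_free_unit unitarymx_unit.
have : (b *: delta_mx 0 i - a *: delta_mx 0 j : 'rV_n) *m P = 0.
  by rewrite mulmxBl -!scalemxAl -!rowE ai bj !scalerA mulrC subrr.
move/eqP; rewrite mulmx_free_eq0 // subr_eq0 => /eqP/rowP/(_ i).
have [//|/negPf ji] := eqVneq j i; have ij : (i == j) = false by rewrite eq_sym.
rewrite !mxE !eqxx ij mulr1 mulr0 => b0.
have : row j P = 0 by rewrite bj b0 scale0r.
rewrite rowE => /eqP; rewrite mulmx_free_eq0 // => /eqP/rowP/(_ j)/eqP.
by rewrite !mxE !eqxx oner_eq0.
Qed.

(** In eigenbasis coordinates a kernel vector satisfies [c 0 i * d i = 0] for each [i], so it
    vanishes if no [d i] does. *)
Lemma card_zero_eigen_gt0 (x : 'rV[R[i]]_n) :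
  x != 0 -> x *m AC = 0 -> (0 < #|[pred i | d i == 0%R]|)%N.
Proof.
move=> xn0 xA; rewrite lt0n; apply: contraNneq xn0 => /card0_eq nz.
have PU := unitarymx_unit Pu.
rewrite -[x](mulmxKV PU); set c := x *m invmx P.
suff -> : c = 0 by rewrite mul0mx.
move: xA; rewrite -[x](mulmxKV PU) -/c ACE !mulmxA -(mulmxA c P).
rewrite (unitarymxP Pu) mulmx1 => /eqP; rewrite mulmx_free_eq0; last first.
  by rewrite row_free_unit.
move=> /eqP/rowP cd; apply/rowP => i; have := cd i.
rewrite mul_mx_diag !mxE => /eqP; rewrite mulf_eq0 => /orP[/eqP //|].
rewrite (inj_eq (@complexI R) _ 0) => di0.
by have := nz i; rewrite !inE di0.
Qed.

End Inertia.

(** * The sesquilinear form of a weighted cycle Laplacian *)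

Lemma jump_form (R : rcfType) n (w : 'I_n -> R) (x y : 'rV[R[i]]_n) :
  let H : 'M[R]_n := \matrix_(i, j) \sum_k w k *
    jump k (delta_mx 0 i) * jump k (delta_mx 0 j) in
  (x *m map_mx (real_complex R) H *m y^t*) 0 0 =
  \sum_k real_complex R (w k) * jump k x * (jump k y)^*.
Proof.
move=> H.
(* As a linear form, [jump k] has real coefficients, which conjugation fixes. *)
have jE k (z : 'rV[R[i]]_n) :
    jump k z = \sum_i z 0 i * real_complex R (jump k (delta_mx 0 i)).
  rewrite {1}/jump {1 2}[z]row_sum_delta !summxE -sumrB; apply: eq_bigr => i _.
  by rewrite /jump !mxE -mulrBr rmorphB !rmorph_nat !eqxx.
transitivity (\sum_j \sum_k real_complex R (w k) * jump k x *
    (real_complex R (jump k (delta_mx 0 j)) * (y 0 j)^*)).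
  rewrite mxE; apply: eq_bigr => j _.
  rewrite !mxE mulr_suml.
  under eq_bigr do rewrite !mxE rmorph_sum mulr_sumr mulr_suml.
  rewrite exchange_big; apply: eq_bigr => k _.
  rewrite [jump k x]jE mulr_sumr mulr_suml; apply: eq_bigr => i _.
  by rewrite !rmorphM /=; ring.
rewrite exchange_big; apply: eq_bigr => k _.
rewrite -mulr_sumr [jump k y]jE rmorph_sum; congr (_ * _); apply: eq_bigr => j _.
rewrite rmorphM mulrC; congr (_ * _).
by rewrite /= conj_Creal ?complex_real.
Qed.

(** Edge [ord_max] closes the cycle; splitting it off leaves the path Laplacian minus a rank-one
    term. Two separate arguments allow a vector to be paired with the linear profile. *)
Lemma jump_form_closing (R : rcfType) m (a : R) (x y : 'rV[R[i]]_m.+1) :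
  let H : 'M[R]_m.+1 := \matrix_(i, j)
    \sum_k (if k == ord_max then - a else a) *
    jump k (delta_mx 0 i) * jump k (delta_mx 0 j) in
  (x *m map_mx (real_complex R) H *m y^t*) 0 0 = real_complex R a *
    (\sum_(k < m) (x 0 (lift ord0 k) - x 0 (widen_ord (leqnSn m) k)) *
         (y 0 (lift ord0 k) - y 0 (widen_ord (leqnSn m) k))^*
     - (x 0 ord0 - x 0 ord_max) * (y 0 ord0 - y 0 ord_max)^*).
Proof.
move=> H; rewrite /H (jump_form (fun k => if k == ord_max then - a else a)).
rewrite big_ord_recr /= eqxx rmorphN [RHS]mulrBr mulr_sumr; congr (_ + _).
  apply: eq_bigr => k _; rewrite ifN; last first.
    by rewrite -val_eqE /= ltn_eqF.
  rewrite /jump (_ : ordS _ = lift ord0 k) ?mulrA //.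
  by apply: val_inj; rewrite /= modn_small // ltnS.
rewrite /jump (_ : ordS ord_max = ord0); first by ring.
by apply: val_inj; rewrite /= modnn.
Qed.

(** * Inertia of the path Laplacian with a negative closing edge *)

Section KuramotoInertia.
Variables (R : rcfType) (m : nat) (a : R).
Hypotheses (m2 : (2 <= m)%N) (a0 : 0 < a).
Let H : 'M[R]_m.+1 := \matrix_(i, j)
  \sum_k (if k == ord_max then - a else a) *
    jump k (delta_mx 0 i) * jump k (delta_mx 0 j).
Let HC := map_mx (real_complex R) H.
Let lin : 'rV[R[i]]_m.+1 := \row_i i%:R.

(** All path increments of [lin] are 1, so the path sum telescopes to the end difference of [x]; the
    closing edge subtracts [m] times that difference. *)
Lemma form_linear_profile (x : 'rV_m.+1) : (x *m HC *m lin^t*) 0 0 =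
  real_complex R a * ((x 0 ord_max - x 0 ord0) * (1 - m%:R)).
Proof.
rewrite jump_form_closing; congr (_ * _).
under eq_bigr => k _.
  rewrite !mxE /= /bump /= natrD addrK conjC1 mulr1.
  over.
have telescope : \sum_(k < m) (x 0 (lift ord0 k) - x 0 (widen_ord (leqnSn m) k)) =
    x 0 ord_max - x 0 ord0.
  have := @big_ord_recl _ 0 +%R m (x 0); rewrite big_ord_recr /= => E.
  by rewrite sumrB; apply/eqP; rewrite subr_eq addrAC eq_sym subr_eq addrC E addrC.
by rewrite telescope !mxE /= sub0r rmorphN /= conjC_nat; ring.
Qed.

Lemma form_diag (x : 'rV_m.+1) : x 0 ord_max = x 0 ord0 ->
  (x *m HC *m x^t*) 0 0 = real_complex R a *
  \sum_(k < m) `|x 0 (lift ord0 k) - x 0 (widen_ord (leqnSn m) k)| ^+ 2.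
Proof.
move=> E; rewrite jump_form_closing E subrr mul0r subr0.
by congr (_ * _); apply: eq_bigr => k _; rewrite normCK.
Qed.

Lemma closing_coef_gt0 : 0 < real_complex R a.
Proof. by rewrite (ltcR 0). Qed.

Lemma ker_closing (x : 'rV_m.+1) : x *m HC = 0 -> exists b, x = b *: const_mx 1.
Proof.
move=> xH.
(* Pairing with [lin] suffices here, as [1 - m] is nonzero for [2 <= m]. *)
have E : x 0 ord_max = x 0 ord0.
  have := form_linear_profile x; rewrite xH mul0mx mxE => /esym/eqP.
  rewrite !mulf_eq0 gt_eqF ?closing_coef_gt0 //= !subr_eq0 => /orP[/eqP //|].
  by rewrite eq_sym pnatr_eq1 gtn_eqF.
have := form_diag E; rewrite xH mul0mx mxE => /esym/eqP.
rewrite mulf_eq0 gt_eqF ?closing_coef_gt0 //= psumr_eq0 => [/allP step|k _]; last first.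
  exact: exprn_ge0.
exists (x 0 0); apply/rowP => -[i im]; rewrite !mxE mulr1.
(* The form at [x] is now a vanishing sum of squares, so equality of neighbours propagates from
   index 0. *)
elim: i im => [|i IH] im; first by congr (x _ _); exact: val_inj.
have im' : (i < m.+1)%N by exact: ltnW.
rewrite -(IH im'); have /implyP := step (Ordinal (im : i < m)%N) (mem_index_enum _).
move=> /(_ isT); rewrite expf_eq0 /= normr_eq0 subr_eq0 => /eqP e.
transitivity (x 0 (lift ord0 (Ordinal (im : i < m)%N))).
  by congr (x 0 _); apply: val_inj; rewrite /= /bump.
by rewrite e; congr (x _ _); exact: val_inj.
Qed.

Lemma const_ker_closing : (const_mx 1 : 'rV_m.+1) *m HC = 0.
Proof.
set v := _ *m _; apply/rowP => j; rewrite [RHS]mxE.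
(* Entry [j] is read off by pairing with a basis vector, and all increments of a constant vector
   vanish. *)
have -> : v 0 j = (v *m (delta_mx 0 j : 'rV_m.+1)^t*) 0 0.
  by rewrite trmx_delta map_delta_mx -colE [RHS]mxE.
rewrite jump_form_closing big1 => [|k _]; last by rewrite !mxE subrr mul0r.
by rewrite !mxE subrr mul0r subr0 mulr0.
Qed.

Lemma closing_inertia : exists s : seq R,
  [/\ char_poly H = \prod_(x <- s) ('X - x%:P), count (fun x => x < 0) s = 1%N,
      count (fun x => x == 0) s = 1%N & count (fun x => 0 < x) s = (m - 1)%N].
Proof.
have Hsym : H^T = H.
  by apply/matrixP => i j; rewrite !mxE; apply: eq_bigr => k _; ring.
have [d [P [Pu HE cp]]] := real_symmetric_spectral Hsym.
exists [seq d i | i <- enum 'I_m.+1].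
have card p : count p [seq d i | i <- enum 'I_m.+1] = #|[pred i | p (d i)]|.
  by rewrite count_map enumT [RHS]cardE /enum_mem size_filter; apply: eq_count.
have neg1 : #|[pred i | (d i < 0)%R]| = 1%N.
  have llin : scalar (fun x : 'rV[R[i]]_m.+1 => x 0 ord_max - x 0 ord0).
    by move=> c x y; rewrite !mxE; ring.
  pose l : {scalar 'rV[R[i]]_m.+1} :=
    HB.pack (fun x : 'rV[R[i]]_m.+1 => x 0 ord_max - x 0 ord0)
      (GRing.isLinear.Build _ _ _ _ _ llin).
  apply/eqP; rewrite eqn_leq; apply/andP; split.
    apply: (card_neg_eigen_le1 Pu HE (l := l)) => x /eqP.
    rewrite subr_eq0 => /eqP E.
    rewrite form_diag // pmulr_rge0 ?closing_coef_gt0 //.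
    by apply: sumr_ge0 => k _; exact: exprn_ge0.
  apply: (card_neg_eigen_gt0 Pu HE (x := lin)).
  (* The value at [lin] is [a * (m * (1 - m))], negative since [2 <= m]. *)
  rewrite form_linear_profile pmulr_rlt0 ?closing_coef_gt0 // !mxE /= subr0.
  by rewrite pmulr_rlt0 ?ltr0n ?(ltnW m2) // subr_lt0 ltr1n.
have zero1 : #|[pred i | (d i == 0)%R]| = 1%N.
  apply/eqP; rewrite eqn_leq; apply/andP; split.
    exact: (card_zero_eigen_le1 Pu HE ker_closing).
  apply: (card_zero_eigen_gt0 Pu HE _ const_ker_closing).
  by apply/eqP => /rowP/(_ 0)/eqP; rewrite !mxE oner_eq0.
split; rewrite ?card //.
  by rewrite cp big_map big_enum.
(* By trichotomy the three counts add up to [m.+1], which fixes the number of positive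
   eigenvalues. *)
have : (count (fun x : R => (x < 0)%R) [seq d i | i <- enum 'I_m.+1] +
  count (fun x : R => (x == 0)%R) [seq d i | i <- enum 'I_m.+1] +
  count (fun x : R => (0 < x)%R) [seq d i | i <- enum 'I_m.+1])%N = m.+1.
  rewrite -[RHS](size_enum_ord) -(size_map d).
  elim: [seq d i | i <- enum 'I_m.+1] => //= x s <-.
  by case: (ltgtP x 0) => _ /=; lia.
by rewrite !card neg1 zero1; lia.
Qed.

End KuramotoInertia.

(** * Phases over the closing edge for half-integer [r] *)

Lemma periodicz (U V : zmodType) (f : U -> V) (T : U) :
  periodic f T -> forall (z : int) a, f (a + T *~ z) = f a.
Proof.
move=> fT [n|n] a; first exact: periodicn.
by rewrite NegzE mulrNz -[in RHS](subrK (T *+ n.+1) a) periodicn.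
Qed.

Section HalfInteger.
Variables (R : realType) (r : R).
Hypothesis r_half : r - 1 / 2 \is a Num.int.

(** With [r = z + 1/2] one has [- 2 * pi * r = pi - 2 * pi * (z + 1)]. Reflection about [pi / 2]
    keeps the sine and negates the cosine. *)
Lemma half_integer_angle x :
  exists z : int, 2 * pi * (- (r + x)) = pi - 2 * pi * x + (pi *+ 2) *~ z.
Proof.
have /intrP[z rz] := r_half; exists (- z - 1).
have -> : r = z%:~R + 1 / 2 by rewrite -rz subrK.
by rewrite -[(pi *+ 2) *~ _]mulrzr intrB rmorphN mulr2n /=; field.
Qed.

Lemma cos_half_integer x : cos (2 * pi * (- (r + x))) = - cos (2 * pi * x).
Proof.
have [z ->] := half_integer_angle x.
by rewrite (periodicz (@cosD2pi R)) addrC cosDpi cosN.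
Qed.

Lemma sin_half_integer x : sin (2 * pi * (- (r + x))) = sin (2 * pi * x).
Proof.
have [z ->] := half_integer_angle x.
by rewrite (periodicz (@sinD2pi R)) addrC sinDpi sinN opprK.
Qed.

End HalfInteger.

(** * Increments of the half-twisted state and the saddle property *)

Lemma jump_half_twisted_state (R : realType) m (r : R) (k : 'I_m.+1) :
  (2 <= m)%N -> jump k (half_twisted_state m.+1 r) =
  if k == ord_max then - (r + r / (m.+1%:R - 2)) else r / (m.+1%:R - 2).
Proof.
move=> m2.
have m1 : m%:R - 1 != 0 :> R by rewrite subr_eq0 pnatr_eq1 gtn_eqF.
rewrite /jump !mxE (_ : m.+1%:R - 2 = m%:R - 1); last by rewrite -natr1; ring.
(* The closing increment is [- r * m / (m - 1)], and [m / (m - 1) = 1 + 1 / (m - 1)]. *)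
have [->|kmax] := eqVneq k ord_max.
  by rewrite /= modnn; field.
have km : (k.+1 < m.+1)%N by rewrite ltn_neqAle ltn_ord andbT.
by rewrite /= modn_small // -natr1; field.
Qed.

Theorem proposition4p6 (R : realType) (n : nat) (K r : R)
    (hn : (3 <= n)%N) (hK : 0 < K)
    (hr_half : r - 1 / 2 \is a Num.int)
    (hr_lo : - (n%:R / 4) + 1 / 2 < r)
    (hr_hi : r < n%:R / 4 - 1 / 2) :
  is_saddle 1 (@kuramoto_potential R n K) (half_twisted_state n r).
Proof.
case: n hn hr_lo hr_hi => // m m2 hr_lo hr_hi.
pose t : R := r / (m.+1%:R - 2).
have jumpE (k : 'I_m.+1) : jump k (half_twisted_state m.+1 r) =
    if k == ord_max then - (r + t) else t by rewrite jump_half_twisted_state.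
(* The bounds on [r] are [-(n - 2) / 4] and [(n - 2) / 4], so [2 * pi * t] lies strictly between
   [- pi / 2] and [pi / 2]. *)
have cos_gt0 : 0 < cos (2 * pi * t).
  have m1 : 0 < m.+1%:R - 2 :> R by rewrite subr_gt0 ltr_nat.
  have tlo : - (1 / 4) < t by rewrite ltr_pdivlMr //; lra.
  have thi : t < 1 / 4 by rewrite ltr_pdivrMr //; lra.
  by apply: cos_gt0_pihalf; have := pi_gt0 R => p0; apply/andP; split; nra.
split; first exact: twice_differentiable_kuramoto_potential.
  split.
    by have [] := is_diff_kuramoto_potential K (half_twisted_state m.+1 r).
  rewrite gradient_kuramoto_potential.
  (* All edges carry the same sine, which factors out of the gradient. *)
  transitivity ((K * sin (2 * pi * t)) *:
      \sum_(k < m.+1) \row_i jump k (delta_mx 0 i : 'rV[R]_m.+1)).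
    rewrite scaler_sumr; apply: eq_bigr => k _; rewrite jumpE.
    by case: ifP => // _; rewrite sin_half_integer.
  apply/rowP => i; rewrite [RHS]mxE mxE summxE.
  under eq_bigr do rewrite mxE.
  (* The increments around the cycle sum to zero because [ordS] permutes the indices. *)
  rewrite sumrB -(reindex_inj (@ordS_inj _) (P := xpredT) (F := delta_mx 0 i 0)).
  by rewrite subrr mulr0.
have a_gt0 : 0 < 2 * pi * K * cos (2 * pi * t) by rewrite !mulr_gt0 ?pi_gt0.
have [s [cp neg zero pos]] := closing_inertia m2 a_gt0.
exists s; split=> //; last by rewrite pos; lia.
(* The Hessian weights are equal on the path edges and opposite on the closing edge, as
   [closing_inertia] requires. *)
rewrite /is_spectrum -cp hessian_kuramoto_potential; congr char_poly.
apply/matrixP => i j; rewrite !mxE; apply: eq_bigr => k _.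
by rewrite jumpE; case: ifP => // _; rewrite cos_half_integer // mulrN.
Qed.
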